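(* Let $\alpha>2$, $\lambda_E>0$, and let $V\subset\mathbb{R}^2$ be a finite set of $N_L\ge 2$ distinct points (legitimate nodes) with two distinct designated nodes $A_S,A_D\in V$. Let $\mathcal{L}$ be the set of all paths from $A_S$ to $A_D$, and for $L\in\mathcal{L}$ let $W(L)=\sum_{i\in L}d_{A_iA_{i+1}}^{\alpha}$ be the sum over the hops of $L$. For each $v\in\{1,\dots,N_L-1\}$ let $\tilde L_v$ be a minimizer of $W(L)$ over all $L\in\mathcal{L}$ with $|L|\le v$. Then $$\min_{L\in\mathcal{L}}K_2(|L|)\,W(L)^{\frac{2}{\alpha}}=\min_{1\le v\le N_L-1}K_2(|\tilde L_v|)\,W(\tilde L_v)^{\frac{2}{\alpha}},$$ where $K_2(n)=\lambda_E\,\frac{\pi\,\Gamma(1-\frac{2}{\alpha})\Gamma(\frac{2}{\alpha}+n)}{\Gamma(n)}$. Consequently, the following algorithm outputs a path attaining the minimum on the left-hand side: (1) run the Bellman-Ford shortest path algorithm from $A_S$ with link weights $d_{A_iA_{j}}^{\alpha}$ and, for each $v=1,\dots,N_L-1$, record as $\tilde L_v$ the path to $A_D$ that is shortest among those with at most $v$ hops, found at iteration $v$; (2) compute $K_2(|\tilde L_v|)W(\tilde L_v)^{2/\alpha}$ for each $v$; (3) output a path $\tilde L_v$ with the smallest computed value. Its computational complexity is $O(N_L^3)$.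
   Context: $d_{XY}$ is the Euclidean distance between the points $X,Y$, and $\Gamma$ is the gamma function. A path from $A_S$ to $A_D$ is a sequence of distinct nodes of $V$ starting at $A_S$ and ending at $A_D$; any two distinct nodes may be consecutive. $|L|$ denotes the number of hops (links) of $L$. Complexity counts elementary operations on real numbers (additions, comparisons, evaluation of powers and of $K_2$) at unit cost. *)

(* Defs.v *)
From HB Require Import structures.
From mathcomp Require Import all_boot all_order all_algebra.
From mathcomp Require Import all_classical all_reals all_analysis.

Set Implicit Arguments.
Unset Strict Implicit.
Unset Printing Implicit Defensive.

Import Order.TTheory GRing.Theory Num.Theory.
Local Open Scope classical_set_scope.
Local Open Scope ring_scope.

(* Euler's integral; it converges for x > 0, the only case of interest. *)
Definition Gamma (R : realType) (x : R) : R :=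
  \int[lebesgue_measure]_(t in `]0%R, +oo[) (t `^ (x - 1) * expR (- t)).

Definition K2 (R : realType) (alpha lambdaE : R) (n : nat) : R :=
  lambdaE * (pi * Gamma (1 - 2 / alpha) * Gamma (2 / alpha + n%:R)
             / Gamma n%:R).

(* The norm of the library on R * R is the sup norm, not the Euclidean one. *)
Definition edist (R : realType) (p q : R * R) : R :=
  Num.sqrt ((p.1 - q.1) ^+ 2 + (p.2 - q.2) ^+ 2).

(* The node set V is given by an injective family pos : 'I_N -> R * R, and a
   path is the sequence of all its nodes, both endpoints included. *)
Definition is_path (N : nat) (AS AD : 'I_N) (L : seq 'I_N) : bool :=
  [&& uniq L, ohead L == Some AS & last AS L == AD].

Definition hops (N : nat) (L : seq 'I_N) : nat := (size L).-1.

Definition W (R : realType) (alpha : R) (N : nat) (pos : 'I_N -> R * R)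
    (L : seq 'I_N) : R :=
  \sum_(e <- zip L (behead L)) edist (pos e.1) (pos e.2) `^ alpha.

Definition objective (R : realType) (alpha lambdaE : R) (N : nat)
    (pos : 'I_N -> R * R) (L : seq 'I_N) : R :=
  K2 alpha lambdaE (hops L) * W alpha pos L `^ (2 / alpha).

Definition W_minimizer (R : realType) (alpha : R) (N : nat)
    (pos : 'I_N -> R * R) (AS AD : 'I_N) (v : nat) (L : seq 'I_N) : Prop :=
  [/\ is_path AS AD L, (hops L <= v)%N &
      forall L', is_path AS AD L' -> (hops L' <= v)%N ->
        W alpha pos L <= W alpha pos L'].

Definition is_min (R : realType) (A : set R) (m : R) : Prop :=
  A m /\ lbound A m.

(* Real-number programs.  Values of type X stand for real numbers.  All programs
   below are polymorphic in X, so that they can only combine and inspect such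
   values through the instructions [Const] (a natural number constant),
   [Arith], [Less] and [EvalK2], each of which has unit cost. *)
Variant arith := Add | Sub | Mul | Div | Pow.

Inductive prog (X A : Type) : Type :=
| Ret of A
| Const of nat & (X -> prog X A)
| Arith of arith & X & X & (X -> prog X A)
| Less of X & X & (bool -> prog X A)
| EvalK2 of nat & (X -> prog X A).

Arguments Ret {X A}.

Fixpoint bind (X A B : Type) (m : prog X A) (f : A -> prog X B) : prog X B :=
  match m with
  | Ret a => f a
  | Const n k => Const n (fun x => bind (k x) f)
  | Arith o x y k => Arith o x y (fun z => bind (k z) f)
  | Less x y k => Less x y (fun b => bind (k b) f)
  | EvalK2 n k => EvalK2 n (fun x => bind (k x) f)
  end.

Notation "'let!' x ':=' m 'in' f" := (bind m (fun x => f))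
  (at level 200, x name, m at level 100, f at level 200).

Definition const (X : Type) (n : nat) : prog X X := Const n Ret.
Definition op (X : Type) (o : arith) (x y : X) : prog X X := Arith o x y Ret.
Definition less (X : Type) (x y : X) : prog X bool := Less x y Ret.
Definition evalK2 (X : Type) (n : nat) : prog X X := EvalK2 n Ret.

(* [powR] is the usual power only for nonnegative bases: squares of coordinate
   differences are therefore computed by [Mul]. *)
Definition arith_sem (R : realType) (o : arith) (x y : R) : R :=
  match o with
  | Add => x + y
  | Sub => x - y
  | Mul => x * y
  | Div => x / y
  | Pow => x `^ y
  end.

Fixpoint result (R : realType) (alpha lambdaE : R) (A : Type)
    (m : prog R A) : A :=
  match m with
  | Ret a => a
  | Const n k => result alpha lambdaE (k n%:R)
  | Arith o x y k => result alpha lambdaE (k (arith_sem o x y))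
  | Less x y k => result alpha lambdaE (k (x < y))
  | EvalK2 n k => result alpha lambdaE (k (K2 alpha lambdaE n))
  end.

Fixpoint cost (R : realType) (alpha lambdaE : R) (A : Type)
    (m : prog R A) : nat :=
  match m with
  | Ret _ => 0%N
  | Const n k => (cost alpha lambdaE (k n%:R)).+1
  | Arith o x y k => (cost alpha lambdaE (k (arith_sem o x y))).+1
  | Less x y k => (cost alpha lambdaE (k (x < y)%R)).+1
  | EvalK2 n k => (cost alpha lambdaE (k (K2 alpha lambdaE n))).+1
  end.

Fixpoint foldM (X A B : Type) (f : B -> A -> prog X A) (s : seq B) (a : A) :
    prog X A :=
  if s is b :: s' then let! a' := f b a in foldM f s' a' else Ret a.

Fixpoint mapM (X A B : Type) (f : A -> prog X B) (s : seq A) :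
    prog X (seq B) :=
  if s is a :: s' then
    let! b := f a in let! r := mapM f s' in Ret (b :: r)
  else Ret [::].

(* The table of the values f j; the default value b is always overwritten. *)
Definition tabulate (X : Type) (N : nat) (B : Type) (b : B)
    (f : 'I_N -> prog X B) : prog X ('I_N -> B) :=
  foldM (fun j t => let! c := f j in Ret (fun i => if i == j then c else t i))
    (enum 'I_N) (fun=> b).

Definition link_weight (X : Type) (alpha half : X) (p q : X * X) : prog X X :=
  let! dx := op Sub p.1 q.1 in
  let! dy := op Sub p.2 q.2 in
  let! dx2 := op Mul dx dx in
  let! dy2 := op Mul dy dy in
  let! d2 := op Add dx2 dy2 in
  let! d := op Pow d2 half in
  op Pow d alpha.

Definition link_weights (X : Type) (alpha : X) (N : nat)
    (pos : 'I_N -> X * X) : prog X ('I_N -> 'I_N -> X) :=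
  let! zero := const X 0 in
  let! one := const X 1 in
  let! two := const X 2 in
  let! half := op Div one two in
  tabulate (fun=> zero) (fun i =>
    tabulate zero (fun j => link_weight alpha half (pos i) (pos j))).

(* Label of a node: the weight and the reversed node sequence of the best walk
   found so far from the source, or None (infinite weight). *)
Definition label (X : Type) (N : nat) : Type := option (X * seq 'I_N).

Definition relax (X : Type) (N : nat) (w : 'I_N -> 'I_N -> X)
    (t : 'I_N -> label X N) (j i : 'I_N) (best : label X N) :
    prog X (label X N) :=
  if i == j then Ret best else
  if t i is Some (x, p) then
    let! y := op Add x (w i j) in
    if best is Some (z, _) then
      let! b := less y z in Ret (if b then Some (y, j :: p) else best)
    else Ret (Some (y, j :: p))
  else Ret best.

(* Every relaxation of an iteration reads the labels t of the previous one, so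
   that the labels after v iterations range over walks with at most v hops. *)
Definition iteration (X : Type) (N : nat) (w : 'I_N -> 'I_N -> X)
    (t : 'I_N -> label X N) : prog X ('I_N -> label X N) :=
  tabulate None (fun j => foldM (relax w t j) (enum 'I_N) (t j)).

(* Performs n iterations and records the label of AD after each of them. *)
Fixpoint iterations (X : Type) (N : nat) (w : 'I_N -> 'I_N -> X) (AD : 'I_N)
    (n : nat) (t : 'I_N -> label X N) : prog X (seq (X * seq 'I_N)) :=
  if n is n'.+1 then
    let! t' := iteration w t in
    let! r := iterations w AD n' t' in
    Ret (if t' AD is Some l then l :: r else r)
  else Ret [::].

Definition bellman_ford (X : Type) (alpha : X) (N : nat) (pos : 'I_N -> X * X)
    (AS AD : 'I_N) : prog X (seq (X * seq 'I_N)) :=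
  let! w := link_weights alpha pos in
  let! zero := const X 0 in
  iterations w AD N.-1
    (fun j => if j == AS then Some (zero, [:: AS]) else None).

Definition evaluate (X : Type) (N : nat) (e : X) (c : X * seq 'I_N) :
    prog X (X * seq 'I_N) :=
  let L := rev c.2 in
  let! k := evalK2 X (hops L) in
  let! u := op Pow c.1 e in
  let! z := op Mul k u in
  Ret (z, L).

Definition select (X : Type) (N : nat) (s : seq (X * seq 'I_N)) :
    prog X (seq 'I_N) :=
  if s is c :: s' then
    let! r := foldM (fun c' best =>
      let! b := less c'.1 best.1 in Ret (if b then c' else best)) s' c in
    Ret r.2
  else Ret [::].

(* The v-th entry (from v = 1) of the first component is the recorded path
   for v; the second component is the output. *)
Definition algorithm (X : Type) (alpha : X) (N : nat) (pos : 'I_N -> X * X)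
    (AS AD : 'I_N) : prog X (seq (seq 'I_N) * seq 'I_N) :=
  let! recorded := bellman_ford alpha pos AS AD in
  let! two := const X 2 in
  let! e := op Div two alpha in
  let! evaluated := mapM (evaluate e) recorded in
  let! out := select evaluated in
  Ret ([seq c.2 | c <- evaluated], out).

(* Main.v *)
Require Import Defs.
From HB Require Import structures.
From mathcomp Require Import all_boot all_order all_algebra.
From mathcomp Require Import all_classical all_reals all_analysis measurable_realfun.
From mathcomp Require Import ring lra zify.

Set Implicit Arguments.
Unset Strict Implicit.
Unset Printing Implicit Defensive.

Import Order.TTheory GRing.Theory Num.Theory.
Local Open Scope classical_set_scope.
Local Open Scope ring_scope.

(** K2 is nonnegative and nondecreasing in the number of hops, by the
    monotonicity of Gamma (s + x) / Gamma x in x.  Hence replacing a path by a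
    W-minimal one within the same number of hops increases neither factor of
    the objective, and the W-minimal paths for v = 1, ..., N - 1 contain a global
    minimizer.  After v iterations the Bellman-Ford labels are optimal among all
    walks with at most v hops; as distinct nodes are at positive distance, an
    optimal walk repeats no node, so it is a path. *)

(** * Monotonicity of K2 *)

(** From [ln u <= u] at [u = t / (2 (a + 1))], since then [a u <= t / 2]. Multiplied by
    [expR (- t)], the bound still decays like [expR (- t / 2)]. *)
Lemma powR_le_expR_half (R : realType) (a t : R) : 0 <= a -> 0 < t ->
  t `^ a <= expR (a * ln (2 * (a + 1))) * expR (t / 2).
Proof.
move=> a0 t0; have b0 : 0 < 2 * (a + 1) by lra.
rewrite /powR gt_eqF// -expRD ler_expR.
have -> : t = t / (2 * (a + 1)) * (2 * (a + 1)).
  by rewrite divfK// gt_eqF.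
set u := t / _; have u0 : 0 < u by rewrite divr_gt0.
rewrite lnM ?posrE// mulrDr addrC lerD2l.
have := ltW (ln_sublinear u0) => lnu.
apply: (@le_trans _ _ (a * u)); first exact: ler_wpM2l.
nra.
Qed.

(** The integrand is dominated by a multiple of the exponential density of rate 1/2; [1 <= x] makes
    the exponent of [t] nonnegative. *)
Lemma integrable_Gamma (R : realType) (x : R) : 1 <= x ->
  lebesgue_measure.-integrable `]0%R, +oo[
    (EFin \o (fun t : R => t `^ (x - 1) * expR (- t))).
Proof.
(* The last factor 2 cancels the factor 1/2 of the density. *)
move=> x1; pose c := expR ((x - 1) * ln (2 * (x - 1 + 1))) * 2.
have int_exp : lebesgue_measure.-integrable `]0%R, +oo[
    (EFin \o (fun t : R => c * exponential_pdf 2^-1 t)).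
  apply: (@integrableS _ _ _ _ setT) => //.
  have half_gt0 : 0 < 2^-1 :> R by rewrite invr_gt0.
  exact: (integrableZl measurableT c (integrable_exponential_pdf half_gt0)).
apply: le_integrable int_exp => //.
  apply/measurable_EFinP; apply: measurable_funM.
    by apply: measurable_funTS; exact: measurable_powR.
  by apply: measurable_funTS; do 2 apply: measurableT_comp => //.
move=> t; rewrite /= in_itv/= andbT => t0.
have fge0 : 0 <= t `^ (x - 1) * expR (- t).
  by rewrite mulr_ge0 ?powR_ge0 ?expR_ge0.
rewrite exponential_pdfE ?(ltW t0)// !ger0_norm//; last first.
  by rewrite !mulr_ge0 ?expR_ge0.
rewrite lee_fin /c.
have -> : expR ((x - 1) * ln (2 * (x - 1 + 1))) * 2 * (2^-1 * expR (- 2^-1 * t))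
  = expR ((x - 1) * ln (2 * (x - 1 + 1))) * expR (t / 2) * expR (- t).
  have -> : - 2^-1 * t = t / 2 + - t by field.
  by rewrite expRD; field.
by rewrite ler_wpM2r ?expR_ge0// powR_le_expR_half// subr_ge0.
Qed.

(** Stated for every [x], to cover also [1 - 2 / alpha], which is below 1 for positive [alpha]. *)
Lemma Gamma_ge0 (R : realType) (x : R) : 0 <= Gamma x.
Proof. by apply: Rintegral_ge0 => t _; rewrite mulr_ge0 ?powR_ge0 ?expR_ge0. Qed.

(** On [[1, 2]], an interval of length 1, the integrand is at least [expR (- 2)]. *)
Lemma Gamma_gt0 (R : realType) (x : R) : 1 <= x -> 0 < Gamma x.
Proof.
move=> x1; have intG := integrable_Gamma x1.
have sub12 : `[1%R, 2%R] `<=` (`]0%R, +oo[ : set R).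
  by move=> t /=; rewrite !in_itv/= andbT => /andP[/(lt_le_trans ltr01)].
have int12 : lebesgue_measure.-integrable `[1%R, 2%R]
    (EFin \o (fun t : R => t `^ (x - 1) * expR (- t))).
  exact: integrableS intG.
have le12 : \int[lebesgue_measure]_(t in `[1%R, 2%R]) (expR (- 2) : R) <=
    \int[lebesgue_measure]_(t in `[1%R, 2%R]) (t `^ (x - 1) * expR (- t)).
  apply: le_Rintegral => //.
    apply: (@continuous_compact_integrable _ (cst (expR (- 2) : R))).
      exact: segment_compact.
    by apply: continuous_subspaceT => z; exact: cvg_cst.
  move=> t /=; rewrite in_itv/= => /andP[t1 t2].
  rewrite -[leLHS]mul1r ler_pM ?expR_ge0 ?ler_expR ?lerN2//.
  by rewrite -[leLHS](powRr0 t) ler_powR// subr_ge0.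
apply: (@lt_le_trans _ _ (\int[lebesgue_measure]_(t in `[1%R, 2%R])
    (t `^ (x - 1) * expR (- t)))).
  apply: lt_le_trans le12; rewrite Rintegral_cst//.
  rewrite [X in fine X](_ : _ = 1%:E); first by rewrite mulr1 expR_gt0.
  by rewrite [LHS]lebesgue_measure_itv/= lte_fin ltr1n -EFinB; congr EFin; ring.
rewrite /Gamma /Rintegral fine_le ?integrable_fin_num//.
apply: ge0_subset_integral => //.
  by move/integrableP: intG => [].
by move=> t _; rewrite lee_fin mulr_ge0 ?powR_ge0 ?expR_ge0.
Qed.

(** The two factors never have opposite signs, as the power [s >= 0] is nondecreasing on nonnegative
    reals. *)
Lemma powR_comonotone (R : realType) (s t c : R) : 0 <= s -> 0 <= t -> 0 <= c ->
  0 <= (t - c) * (t `^ s - c `^ s).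
Proof.
move=> s0 t0 c0; have [tc|/ltW ct] := leP t c.
  by rewrite mulr_le0 ?subr_le0// ge0_ler_powR.
by rewrite mulr_ge0 ?subr_ge0// ge0_ler_powR.
Qed.

(* With c = Gamma (x + 1) / Gamma x, integrate
   (t - c) (t ^ s - c ^ s) >= 0 against t ^ (x - 1) e ^ (- t): the terms in c ^ s
   cancel. *)
Lemma Gamma_ratio_le (R : realType) (x s : R) : 1 <= x -> 0 <= s ->
  Gamma (s + x) / Gamma x <= Gamma (s + (x + 1)) / Gamma (x + 1).
Proof.
move=> x1 s0.
have x11 : 1 <= x + 1 by lra.
have sx1 : 1 <= s + x by lra.
have sx11 : 1 <= s + (x + 1) by lra.
have i1 := integrable_Gamma x1.
have i2 := integrable_Gamma x11.
have i3 := integrable_Gamma sx1.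
have i4 := integrable_Gamma sx11.
have Gx := Gamma_gt0 x1.
have Gx1 := Gamma_gt0 x11.
pose c := Gamma (x + 1) / Gamma x.
have c0 : 0 < c := divr_gt0 Gx1 Gx.
pose g (y t : R) := t `^ (y - 1) * expR (- t).
pose D : set R := `]0%R, +oo[%classic.
have iZ (k y : R) : lebesgue_measure.-integrable D (EFin \o g y) ->
    lebesgue_measure.-integrable D (EFin \o (fun t => k * g y t)).
  move=> h.
  apply: (@integrableZl _ _ _ lebesgue_measure D _ k (EFin \o g y)) => //.
  exact: measurable_itv.
(* The product is expanded into multiples of four Gamma integrands, so that the integral splits term
   by term. *)
have : 0 <= \int[lebesgue_measure]_(t in D)
    (g (s + (x + 1)) t - c * g (s + x) t
       - (c `^ s * g (x + 1) t - c `^ s * c * g x t)).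
  apply: Rintegral_ge0 => t; rewrite /D/= in_itv/= andbT => t0.
  have t_neq0 : t != 0 by rewrite gt_eqF.
  have -> : g (s + (x + 1)) t - c * g (s + x) t
       - (c `^ s * g (x + 1) t - c `^ s * c * g x t) =
     (t - c) * (t `^ s - c `^ s) * (t `^ (x - 1) * expR (- t)).
    rewrite /g (_ : s + (x + 1) - 1 = 1 + (s + (x - 1))); last ring.
    rewrite (_ : s + x - 1 = s + (x - 1)); last ring.
    rewrite (_ : x + 1 - 1 = 1 + (x - 1)); last ring.
    rewrite !powRD ?t_neq0 ?implybT// powRr1 ?(ltW t0)//; ring.
  rewrite mulr_ge0 ?powR_comonotone ?(ltW c0) ?(ltW t0)//.
  by rewrite mulr_ge0 ?powR_ge0 ?expR_ge0.
have iB (f h : R -> R) : lebesgue_measure.-integrable D (EFin \o f) ->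
    lebesgue_measure.-integrable D (EFin \o h) ->
    lebesgue_measure.-integrable D (EFin \o (fun t => f t - h t)).
  move=> fi hi.
  apply: (@integrableB _ _ _ lebesgue_measure D _ (EFin \o f) (EFin \o h)) => //.
  exact: measurable_itv.
have mD := @measurable_itv R `]0, +oo[.
rewrite RintegralB; [|exact: mD|by apply: iB; [exact: i4|exact: iZ]
  |by apply: iB; exact: iZ].
rewrite RintegralB; [|exact: mD|exact: i4|exact: iZ].
rewrite RintegralB; [|exact: mD|exact: iZ|exact: iZ].
do 3 (rewrite RintegralZl; [|exact: mD|assumption]).
rewrite -!/(Gamma _) -mulrA.
move: Gx Gx1; rewrite /c.
move: (Gamma x) (Gamma (x + 1)) (Gamma (s + x)) (Gamma (s + (x + 1))).
move=> G G1 Gs Gs1 G_gt0 G1_gt0.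
(* The cancellation: [c * Gamma x = Gamma (x + 1)] by the choice of [c]. *)
rewrite divfK ?gt_eqF// subrr subr0 subr_ge0 => le_Gs1.
by rewrite ler_pdivlMr// mulrAC -mulrA mulrC.
Qed.

Lemma K2_ge0 (R : realType) (alpha lambdaE : R) (n : nat) :
  0 < lambdaE -> 0 <= K2 alpha lambdaE n.
Proof.
by move=> l0; rewrite mulr_ge0 ?(ltW l0)// divr_ge0 ?mulr_ge0 ?Gamma_ge0 ?pi_ge0.
Qed.

(** [K2] is a nonnegative constant times [Gamma (s + n) / Gamma n] with [s = 2 / alpha], so the
    ratio inequality applies at [x = n]. *)
Lemma K2_leS (R : realType) (alpha lambdaE : R) (n : nat) :
  0 < alpha -> 0 < lambdaE -> (1 <= n)%N ->
  K2 alpha lambdaE n <= K2 alpha lambdaE n.+1.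
Proof.
move=> a0 l0 n1.
have n1R : 1 <= n%:R :> R by rewrite ler1n.
have s0 : 0 <= 2 / alpha by rewrite divr_ge0// ltW.
have := Gamma_ratio_le n1R s0; rewrite (natr1 n) /K2.
have := Gamma_ge0 (1 - 2 / alpha).
move: (Gamma (1 - _)) (Gamma (_ + n%:R)) (Gamma n%:R) (Gamma (_ + n.+1%:R))
  (Gamma n.+1%:R) => G Gsn Gn GsSn GSn G0 le_ratio.
by rewrite -!mulrA !ler_wpM2l ?pi_ge0// ltW.
Qed.

Lemma K2_homo (R : realType) (alpha lambdaE : R) (m n : nat) :
  0 < alpha -> 0 < lambdaE -> (1 <= m)%N -> (m <= n)%N ->
  K2 alpha lambdaE m <= K2 alpha lambdaE n.
Proof.
move=> a0 l0 m1.
have := fun k => @K2_leS R alpha lambdaE k a0 l0.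
move: (K2 alpha lambdaE) => K K_leS.
elim: n => [|n IHn]; first by case: m m1.
rewrite leq_eqVlt => /predU1P[->//|mn].
exact: le_trans (IHn mn) (K_leS _ (leq_trans m1 mn)).
Qed.

(** * Results and costs of programs *)

Section Semantics.
Context {R : realType}.
Variables alpha lambdaE : R.
Local Notation result := (result alpha lambdaE).
Local Notation cost := (cost alpha lambdaE).

Lemma result_bind A B (m : prog R A) (f : A -> prog R B) :
  result (bind m f) = result (f (result m)).
Proof. by elim: m => //=. Qed.

Lemma cost_bind A B (m : prog R A) (f : A -> prog R B) :
  cost (bind m f) = (cost m + cost (f (result m)))%N.
Proof. by elim: m => //= *; rewrite addSn; congr S. Qed.

Lemma result_foldM A B (f : B -> A -> prog R A) (s : seq B) (a : A) :
  result (foldM f s a) = foldl (fun a b => result (f b a)) a s.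
Proof. by elim: s a => //= b s IHs a; rewrite result_bind IHs. Qed.

Lemma cost_foldM_le A B (f : B -> A -> prog R A) (c : nat) (s : seq B) (a : A) :
  (forall b a, cost (f b a) <= c)%N -> (cost (foldM f s a) <= c * size s)%N.
Proof.
move=> fc; elim: s a => //= b s IHs a.
by rewrite cost_bind mulnS leq_add.
Qed.

Lemma result_mapM A B (f : A -> prog R B) (s : seq A) :
  result (mapM f s) = [seq result (f a) | a <- s].
Proof. by elim: s => //= a s IHs; rewrite !result_bind IHs. Qed.

Lemma cost_mapM_le A B (f : A -> prog R B) (c : nat) (s : seq A) :
  (forall a, cost (f a) <= c)%N -> (cost (mapM f s) <= c * size s)%N.
Proof.
move=> fc; elim: s => //= a s IHs.
by rewrite !cost_bind/= addn0 mulnS leq_add.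
Qed.

Lemma result_tabulate N B (b : B) (f : 'I_N -> prog R B) (i : 'I_N) :
  result (tabulate b f) i = result (f i).
Proof.
rewrite /tabulate result_foldM.
(* Generalized to any list [s] of indices and any initial table [t]: entries outside [s] stay
   untouched. *)
suff fill (s : seq 'I_N) (t : 'I_N -> B) :
    foldl (fun t j => result (let! c := f j in
      Ret (fun i => if i == j then c else t i))) t s i =
    if i \in s then result (f i) else t i by rewrite fill mem_enum.
elim: s t => //= j s IHs t; rewrite IHs result_bind/= inE.
by case: (i \in s); rewrite ?orbT// orbF; case: eqP => [->|].
Qed.

Lemma cost_tabulate_le N B (b : B) (f : 'I_N -> prog R B) (c : nat) :
  (forall i, cost (f i) <= c)%N -> (cost (tabulate b f) <= c * N)%N.
Proof.
move=> fc; rewrite -[X in (_ * X)%N](size_enum_ord N).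
by apply: cost_foldM_le => j t; rewrite cost_bind/= addn0.
Qed.

(** The accumulator is the best candidate so far; the induction generalizes over it. *)
Lemma result_select N (s : seq (R * seq 'I_N)) : s != [::] ->
  exists2 r, r \in s /\ (forall c, c \in s -> r.1 <= c.1)
    & result (select s) = r.2.
Proof.
case: s => //= c s _; rewrite result_bind/= result_foldM.
set r := foldl _ _ _; exists r => //.
rewrite {}/r; elim: s c => [|c' s IHs] c /=.
  by split => [|_ /[!inE]/eqP->]; rewrite ?inE.
have [+ +] := IHs (if c'.1 < c.1 then c' else c).
set r := foldl _ _ _ => r_in r_min; split.
  move: r_in; rewrite !inE; case: ifP => _ /orP[->|->]; rewrite ?orbT//.
have := r_min _ (mem_head _ _); case: ltP => cc' rc d.
- rewrite !inE => /or3P[/eqP->|/eqP->//|ds].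
    exact: le_trans rc (ltW cc').
  by apply: r_min; rewrite inE ds orbT.
- rewrite !inE => /or3P[/eqP->//|/eqP->|ds].
    exact: le_trans rc cc'.
  by apply: r_min; rewrite inE ds orbT.
Qed.

Lemma cost_select_le N (s : seq (R * seq 'I_N)) : (cost (select s) <= size s)%N.
Proof.
case: s => //= c s; rewrite cost_bind/= addn0.
apply: (leq_trans (@cost_foldM_le _ _ _ 1 _ _ _)) => //.
by rewrite mul1n.
Qed.

End Semantics.

(** * Walks and Bellman-Ford labels *)

Lemma not_uniq_split (T : eqType) (s : seq T) : ~~ uniq s ->
  exists a b c x, s = a ++ x :: b ++ x :: c.
Proof.
elim: s => //= y s IHs; rewrite negb_and negbK => /orP[/splitPr[b c]|/IHs].
  by exists [::], b, c, y.
by move=> [a [b [c [x ->]]]]; exists (y :: a), b, c, x.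
Qed.

Section Walks.
Context {R : realType}.
Variables (alpha : R) (N : nat) (pos : 'I_N -> R * R).
Local Notation W := (W alpha pos).

Definition weight (i j : 'I_N) : R := Defs.edist (pos i) (pos j) `^ alpha.

Lemma weight_ge0 i j : 0 <= weight i j.
Proof. exact: powR_ge0. Qed.

Lemma weight_gt0 i j : injective pos -> i != j -> 0 < weight i j.
Proof.
move=> pos_inj ij; rewrite powR_gt0// sqrtr_gt0.
rewrite lt_def addr_ge0 ?sqr_ge0// andbT.
apply: contra ij; rewrite paddr_eq0 ?sqr_ge0// !sqrf_eq0 !subr_eq0.
move=> /andP[/eqP x /eqP y]; apply/eqP/pos_inj.
by case: (pos i) (pos j) x y => ? ? [? ?] /= -> ->.
Qed.

Lemma W_seq1 i : W [:: i] = 0.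
Proof. by rewrite /W /= big_nil. Qed.

Lemma W_cons2 i j L : W [:: i, j & L] = weight i j + W (j :: L).
Proof. by rewrite /W /= big_cons. Qed.

Lemma W_ge0 L : 0 <= W L.
Proof. by apply: sumr_ge0 => e _; exact: powR_ge0. Qed.

(** The node [i] ends one part and starts the other, so no hop is lost in the split. *)
Lemma W_cat L i L' : W (L ++ i :: L') = W (rcons L i) + W (i :: L').
Proof.
elim: L => [|j L IHL]; first by rewrite W_seq1 add0r.
by case: L IHL => [_|k L IHL]; rewrite /= !W_cons2 ?IHL ?W_seq1 ?addr0 ?addrA.
Qed.

Lemma W_rcons i q j : W (i :: rcons q j) = W (i :: q) + weight (last i q) j.
Proof.
elim: q i => [|k q IHq] i; first by rewrite /= W_cons2 !W_seq1 addrC.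
by rewrite /= !W_cons2 IHq addrA.
Qed.

(* A walk from AS is represented by the sequence q of its nodes after AS;
   it has size q hops. *)
Variable AS : 'I_N.

Definition walk_to (j : 'I_N) (v : nat) (q : seq 'I_N) : Prop :=
  last AS q = j /\ (size q <= v)%N.

(* A repeated node closes a loop of positive weight, which could be cut out. *)
Lemma shortest_walk_uniq v j q : injective pos ->
  path (fun i j => i != j) AS q -> walk_to j v q ->
  (forall q', walk_to j v q' -> W (AS :: q) <= W (AS :: q')) -> uniq (AS :: q).
Proof.
move=> pos_inj qpath [qlast qv] qmin; apply: contraT => /not_uniq_split.
move=> [a [b [c [x qE]]]].
(* [q'] is the walk with the loop cut out. If [a] is empty, the loop starts at [AS = x], which
   remains the first node. *)
have [q' q'E] : exists q', AS :: q' = a ++ x :: c.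
  by case: a qE => [[-> _]|y a [-> _]]; [exists c | exists (a ++ x :: c)].
(* Consecutive nodes of [q] differ, so [b] is nonempty and the first hop of the loop has positive
   weight. *)
have loop_gt0 : 0 < W (x :: b ++ [:: x]).
  have : sorted (fun i j => i != j) (a ++ x :: b ++ x :: c) by rewrite -qE.
  case/cat_sorted2 => _; case: b {qE} => [|y b] /=; first by rewrite eqxx.
  move=> /andP[xy _]; rewrite W_cons2.
  by rewrite ltr_pwDl ?weight_gt0 ?W_ge0.
have q'_walk : walk_to j v q'.
  split.
    rewrite -[LHS]/(last AS (AS :: q')) q'E last_cat/=.
    by rewrite -qlast -[RHS]/(last AS (AS :: q)) qE last_cat/= last_cat.
  have := congr1 size qE; have := congr1 size q'E.
  rewrite /= !size_cat/= size_cat/= => *; lia.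
have := qmin q' q'_walk.
(* Removing the common parts from both sides leaves a loop of weight at most 0. *)
rewrite qE q'E (W_cat a x (b ++ x :: c)) (W_cat a x c) lerD2l.
by rewrite -cat_cons W_cat -cats1 cat_cons gerDr leNgt loop_gt0.
Qed.

(* In the course of an iteration, Q consists of the walks with at most v hops
   and the one-hop extensions to j examined so far. *)
Definition optimal_label (j : 'I_N) (v : nat) (Q : seq 'I_N -> Prop)
    (l : label R N) : Prop :=
  if l is Some (x, p) then
    (exists q, [/\ rev p = AS :: q, x = W (AS :: q), walk_to j v q
       & path (fun i j => i != j) AS q])
    /\ forall q, Q q -> x <= W (AS :: q)
  else forall q, ~ Q q.

Lemma sub_optimal_label j v Q Q' l : (forall q, Q' q -> Q q) ->
  optimal_label j v Q l -> optimal_label j v Q' l.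
Proof.
move=> sub; case: l => [[x p]|] /=; last by move=> h q /sub; exact: h.
by move=> [ex h]; split=> // q /sub; exact: h.
Qed.

(** * Optimality of labels under relaxation and iteration *)

Variable lambdaE : R.
Variable w : 'I_N -> 'I_N -> R.
Hypothesis wE : forall i j, w i j = weight i j.
Local Notation result := (result alpha lambdaE).
Local Notation cost := (cost alpha lambdaE).

Definition extended_walk (i j : 'I_N) (v : nat) (q : seq 'I_N) : Prop :=
  exists2 q', q = rcons q' j & walk_to i v q'.

(** For [i != j] the candidate is a lightest walk to [i] plus the hop to [j], hence minimal among
    the extensions through [i]; the comparison keeps the lighter of it and [best]. *)
Lemma relax_optimal t j i v Q best :
  (forall q, walk_to j v q -> Q q) ->
  optimal_label i v (walk_to i v) (t i) ->
  optimal_label j v.+1 Q best ->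
  optimal_label j v.+1 (fun q => Q q \/ extended_walk i j v q)
    (result (relax w t j i best)).
Proof.
move=> QW ti_opt best_opt; rewrite /relax.
have [ij|ij] := eqVneq i j.
  (* No relaxation of [j] from itself: an extension that repeats [j] weighs at least as much as its
     prefix, which is in [Q] by [QW]. *)
  move: best_opt; rewrite /=; case: best => [[z r]|] /= best_opt.
    case: best_opt => ex z_min; split=> // q [/z_min//|[q' -> q'_walk]].
    rewrite W_rcons; have /z_min/le_trans : Q q' by apply: QW; rewrite -ij.
    by apply; rewrite lerDl weight_ge0.
  move=> q [/best_opt//|[q' _ q'_walk]].
  by apply: (best_opt q'); apply: QW; rewrite -ij.
case: (t i) ti_opt => [[x p]|] /=; last first.
  move=> no_walk; apply: sub_optimal_label best_opt => q [//|[q' _ q'_walk]].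
  by case: (no_walk _ q'_walk).
case=> -[q0 [pE xE [q0_last q0_size] q0_path]] x_min.
have new_walk : exists q, [/\ rev (j :: p) = AS :: q, x + w i j = W (AS :: q),
    walk_to j v.+1 q & path (fun i j => i != j) AS q].
  exists (rcons q0 j); split.
  - by rewrite rev_cons pE.
  - by rewrite W_rcons q0_last wE xE.
  - by split; rewrite ?last_rcons ?size_rcons.
  - by rewrite rcons_path q0_path q0_last.
have new_min q : extended_walk i j v q -> x + w i j <= W (AS :: q).
  move=> [q' -> q'_walk]; rewrite W_rcons (proj1 q'_walk) wE lerD2r.
  exact: x_min.
case: best best_opt => [[z r]|] /= best_opt; last first.
  by split=> // q [/best_opt//|/new_min].
case: best_opt => ex z_min; case: ltP => xz /=; split=> // q.
  by move=> [/z_min|/new_min//]; apply: le_trans; exact: ltW.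
by move=> [/z_min//|/new_min]; apply: le_trans.
Qed.

(** Each relaxation enlarges [Q] by the extensions just examined, so the induction generalizes over
    [Q] and [best]. *)
Lemma foldl_relax_optimal t j v (s : seq 'I_N) Q best :
  (forall q, walk_to j v q -> Q q) ->
  (forall i, optimal_label i v (walk_to i v) (t i)) ->
  optimal_label j v.+1 Q best ->
  optimal_label j v.+1
    (fun q => Q q \/ exists2 i, i \in s & extended_walk i j v q)
    (foldl (fun l i => result (relax w t j i l)) best s).
Proof.
move=> QW t_opt; elim: s Q best QW => [|i s IHs] Q best QW best_opt /=.
  by apply: sub_optimal_label best_opt => q [//|[]].
have := IHs _ _ _ (relax_optimal QW (t_opt i) best_opt).
move=> /(_ (fun q h => or_introl (QW q h))); apply: sub_optimal_label.
move=> q [|[k]]; first by left; left.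
rewrite inE => /predU1P[->|ks] ?; first by left; right.
by right; exists k.
Qed.

(** A walk to [j] with at most [v + 1] hops either has at most [v], and is covered by the initial
    label [t j], or extends a walk of [v] hops to its penultimate node. *)
Lemma iteration_optimal t v :
  (forall i, optimal_label i v (walk_to i v) (t i)) ->
  forall j, optimal_label j v.+1 (walk_to j v.+1) (result (iteration w t) j).
Proof.
move=> t_opt j; rewrite result_tabulate result_foldM.
have best_opt : optimal_label j v.+1 (walk_to j v) (t j).
  move: (t_opt j); case: (t j) => [[x p]|] //= [[q [? ? [? qv] ?]] ?].
  by split=> //; exists q; split=> //; split=> //; exact: leqW.
have := foldl_relax_optimal (enum 'I_N) (fun q h => h) t_opt best_opt.
apply: sub_optimal_label => q [qlast qv].
have [qv'|vq] := leqP (size q) v; first by left.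
(* The witness is the penultimate node, which is [AS] for a single hop. *)
right; exists (last AS (belast AS q)); first exact: mem_enum.
case/lastP: q qlast qv vq => [//|q k].
rewrite last_rcons size_rcons belast_rcons/= => -> qv _.
by exists q.
Qed.

(** Entry [k], counted from 0, belongs to iteration [k + 1] and thus to the bound [v + k + 1]. *)
Lemma result_iterations AD n t v :
  (forall i, optimal_label i v (walk_to i v) (t i)) ->
  let r := result (iterations w AD n t) in
  size r = n /\ forall k, (k < n)%N ->
    optimal_label AD (v + k.+1) (walk_to AD (v + k.+1)) (Some (nth (0, [::]) r k)).
Proof.
elim: n t v => [|n IHn] t v t_opt //=.
rewrite !result_bind/=.
have t'_opt := iteration_optimal t_opt.
move: (t'_opt AD); case: (result (iteration w t) AD) => [l|] l_opt; last first.
  (* The label of [AD] cannot be [None], as the single hop to [AD] is a walk within the bound; hence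
     every iteration records an entry. *)
  by case: (l_opt [:: AD]); split.
have [r_size r_opt] := IHn _ _ t'_opt.
split=> [|[_|k kn]]; [by rewrite /= r_size|by rewrite addn1|].
by rewrite -addSnnS; exact: r_opt.
Qed.

Lemma optimal_label_source (i : 'I_N) : optimal_label i 0 (walk_to i 0)
  (if i == AS then Some (0, [:: AS]) else None).
Proof.
case: eqP => [->|iAS] /=; last first.
  by move=> q [qi]; rewrite leqn0 => /nilP q0; apply: iAS; rewrite -qi q0.
split; last by move=> q _; exact: W_ge0.
by exists [::]; rewrite W_seq1.
Qed.

Lemma is_pathP AD L : is_path AS AD L ->
  exists2 q, L = AS :: q & last AS q = AD /\ uniq (AS :: q).
Proof.
case: L => [/and3P[]//|i q /and3P[uq /eqP[iE] /eqP qlast]].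
by rewrite iE in uq qlast *; exists q.
Qed.

(** Paths are walks, so a lightest walk that happens to be a path is also a lightest path. *)
Lemma optimal_label_minimizer AD v x p : injective pos ->
  optimal_label AD v (walk_to AD v) (Some (x, p)) ->
  x = W (rev p) /\ W_minimizer alpha pos AS AD v (rev p).
Proof.
move=> pos_inj [[q [-> -> q_walk q_path]] q_min]; split=> //.
have q_uniq := shortest_walk_uniq pos_inj q_path q_walk q_min.
case: q_walk => q_last q_size; split=> //.
  by rewrite /is_path q_uniq /= eqxx q_last eqxx.
by move=> _ /is_pathP[q' -> [q'_last _]] q'_size; apply: q_min.
Qed.

End Walks.

(** * The algorithm *)

Lemma ex_argmin_range (R : realType) (n : nat) (f : nat -> R) : (0 < n)%N ->
  exists2 v, (1 <= v <= n)%N &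
    forall v', (1 <= v' <= n)%N -> f v <= f v'.
Proof.
case: n => // n _.
have [i _ i_min] := @Order.TotalTheory.arg_minP _ R 'I_n.+1 ord0 xpredT
  (fun i => f i.+1) isT.
exists i.+1; first by rewrite ltn_ord.
by move=> [//|v'] /= v'n; exact: (i_min (Ordinal v'n)).
Qed.

Section Algorithm.
Context {R : realType}.
Variables (alpha lambdaE : R) (N : nat) (pos : 'I_N -> R * R).
Local Notation W := (W alpha pos).
Local Notation obj := (objective alpha lambdaE pos).
Local Notation result := (result alpha lambdaE).
Local Notation cost := (cost alpha lambdaE).

(** The power 1/2 of the nonnegative sum of squares is its square root. *)
Lemma result_link_weights i j :
  result (link_weights alpha pos) i j = weight alpha pos i j.
Proof.
rewrite /link_weights /= !result_tabulate /= /weight /Defs.edist -!expr2.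
by rewrite mul1r powR12_sqrt// addr_ge0 ?sqr_ge0.
Qed.

(** Four instructions produce the constants and one half; each of the [N * N] links takes seven
    more. *)
Lemma cost_link_weights_le :
  (cost (link_weights alpha pos) <= 4 + 7 * N * N)%N.
Proof.
rewrite /link_weights /= -[X in (_ <= X)%N]/((7 * N * N).+4) !ltnS.
by apply: cost_tabulate_le => i; exact: cost_tabulate_le.
Qed.

(** Each ordered pair of nodes costs at most one addition and one comparison. *)
Lemma cost_iteration_le (w : 'I_N -> 'I_N -> R) (t : 'I_N -> label R N) :
  (cost (iteration w t) <= 2 * N * N)%N.
Proof.
apply: cost_tabulate_le => j; rewrite -[X in (_ * X)%N](size_enum_ord N).
apply: cost_foldM_le => i best; rewrite /relax.
by case: (i == j) => //; case: (t i) => [[x p]|]//; case: best => [[z q]|].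
Qed.

Lemma cost_iterations_le (w : 'I_N -> 'I_N -> R) (AD : 'I_N) (n : nat)
    (t : 'I_N -> label R N) : (cost (iterations w AD n t) <= 2 * N * N * n)%N.
Proof.
elim: n t => //= n IHn t; rewrite !cost_bind/= addn0 mulnS.
exact: leq_add (cost_iteration_le _ _) (IHn _).
Qed.

Variables AS AD : 'I_N.
Hypothesis pos_inj : injective pos.

Lemma bellman_ford_minimizers :
  let r := result (bellman_ford alpha pos AS AD) in
  size r = N.-1 /\ forall v, (v < N.-1)%N ->
    let c := nth (0, [::]) r v in
    c.1 = W (rev c.2) /\ W_minimizer alpha pos AS AD v.+1 (rev c.2).
Proof.
rewrite /bellman_ford result_bind/=.
have [-> r_opt] := result_iterations lambdaE result_link_weights AD N.-1
  (optimal_label_source alpha pos AS).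
split=> // v /r_opt; rewrite add0n; set c := nth _ _ _.
by case: c => x p; exact: optimal_label_minimizer.
Qed.

Lemma result_algorithm (a := result (algorithm alpha pos AS AD)) : (2 <= N)%N ->
  [/\ size a.1 = N.-1,
      forall v, (v < N.-1)%N ->
        W_minimizer alpha pos AS AD v.+1 (nth [::] a.1 v),
      a.2 \in a.1 &
      forall L, L \in a.1 -> obj a.2 <= obj L].
Proof.
move=> N_ge2; have [r_size r_min] := bellman_ford_minimizers.
(* Each label carries the exact weight of its path, so the evaluated numbers are the objective
   values of the recorded paths. *)
have {a}-> : a = ([seq rev c.2 | c <- result (bellman_ford alpha pos AS AD)],
    result (select [seq (obj L, L) | L <-
      [seq rev c.2 | c <- result (bellman_ford alpha pos AS AD)]])).
  rewrite /a /algorithm result_bind.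
  set r := result _ in r_size r_min *.
  rewrite /= result_bind (result_mapM alpha lambdaE (evaluate (2 / alpha)) r).
  rewrite result_bind/=.
  have -> : [seq result (evaluate (2 / alpha) c) | c <- r] =
            [seq (obj L, L) | L <- [seq rev c.2 | c <- r]].
    rewrite -map_comp; apply/eq_in_map => c /(nthP (0, [::]))[v].
    by rewrite r_size => /r_min[+ _] <-; rewrite /evaluate/= => ->.
  by congr pair; rewrite -map_comp map_id.
set r := result _ in r_size r_min *; set s := [seq rev c.2 | c <- r].
have s_nth v : (v < N.-1)%N -> nth [::] s v = rev (nth (0, [::]) r v).2.
  by move=> vN; rewrite (nth_map (0, [::])) ?r_size.
have s_size : size s = N.-1 by rewrite size_map.
have : [seq (obj L, L) | L <- s] != [::].
  by rewrite -size_eq0 size_map s_size -lt0n; lia.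
move=> /(@result_select _ alpha lambdaE)[c [c_in c_min]] /= ->.
case/mapP: c_in c_min => L Ls -> /= c_min; split=> //.
- by move=> v vN; rewrite s_nth//; case: (r_min _ vN).
- by move=> L' L's; apply: (c_min (obj L', L')); exact: map_f.
Qed.

(** The constant is [20 = 7 + 7 + 2 + 4]: seven single instructions, [7 N^2] for the links, at most
    [2 N^3] for the iterations and at most [4 N] for evaluation and selection. *)
Lemma cost_algorithm_le : (2 <= N)%N ->
  (cost (algorithm alpha pos AS AD) <= 20 * N ^ 3)%N.
Proof.
move=> N_ge2; have [r_size _] := bellman_ford_minimizers.
have bf_le : (cost (bellman_ford alpha pos AS AD) <=
    4 + 7 * N * N + (2 * N * N * N.-1).+1)%N.
  rewrite /bellman_ford cost_bind/= leq_add ?cost_link_weights_le// ltnS.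
  exact: cost_iterations_le.
rewrite /algorithm cost_bind.
move: (result _) (cost (bellman_ford _ _ _ _)) r_size bf_le => r bf r_size bf_le.
rewrite /= cost_bind (result_mapM alpha lambdaE (evaluate (2 / alpha)) r).
rewrite cost_bind/= addn0.
have ev_le : (cost (mapM (evaluate (2 / alpha)) r) <= 3 * N.-1)%N.
  by rewrite -r_size; exact: cost_mapM_le.
have se_le : (cost (select [seq result (evaluate (2 / alpha) c) | c <- r]) <=
    N.-1)%N.
  apply: leq_trans (cost_select_le _ _ _) _.
  by rewrite size_map r_size.
have N_gt0 : (0 < N)%N by exact: ltnW.
have bf_le' : (bf <= 4 + 7 * (N * N) + (2 * (N * N * N)).+1)%N.
  apply: leq_trans bf_le _; rewrite -(mulnA 7) -(mulnA 2) -(mulnA 2).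
  by rewrite leq_add2l ltnS leq_mul2l leq_mul2l leq_pred !orbT.
have NN : (N <= N * N)%N by rewrite leq_pmull.
have NNN : (N * N <= N * N * N)%N by rewrite leq_pmulr.
have -> : (N ^ 3 = N * N * N)%N by rewrite !expnS expn0 muln1 mulnA.
move: (N * N * N)%N (N * N)%N (cost _) (cost _) NN NNN ev_le se_le bf_le'.
move=> N3 N2 ev se *; lia.
Qed.

(** * Reduction of the global minimum to the [W]-minimal paths *)

Hypothesis alpha_gt2 : 2 < alpha.
Hypothesis lambdaE_gt0 : 0 < lambdaE.
Hypothesis AS_neq_AD : AS != AD.

Lemma hops_gt0 L : is_path AS AD L -> (0 < hops L)%N.
Proof.
move=> /is_pathP[[|i q] -> [/= ASD _]] //.
by move: AS_neq_AD; rewrite ASD eqxx.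
Qed.

Lemma hops_le L : is_path AS AD L -> (hops L <= N.-1)%N.
Proof.
move=> /and3P[uL _ _]; rewrite /hops -!subn1 leq_sub2r//.
by rewrite -(card_uniqP uL) (leq_trans (max_card _)) ?card_ord.
Qed.

(* An optimal path within |L| hops has at most as many hops as L, so the
   monotonicity of K2 does not increase the first factor. *)
Lemma objective_minimizer_le Lv L : is_path AS AD L ->
  W_minimizer alpha pos AS AD (hops L) Lv -> obj Lv <= obj L.
Proof.
move=> pL [pLv hLv minLv].
have alpha_gt0 : 0 < alpha := lt_trans (ltr0n R 2) alpha_gt2.
apply: ler_pM; [exact: K2_ge0|exact: powR_ge0
  |exact: K2_homo (hops_gt0 pLv) hLv|].
by rewrite ge0_ler_powR ?nnegrE ?W_ge0 ?divr_ge0 ?(ltW alpha_gt0)// minLv.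
Qed.

Local Notation global_min :=
  (is_min [set obj L | L in [set L | is_path AS AD L]]).

(** An arbitrary path [L] is compared with the minimizer at [hops L], an index in the range, and
    that minimizer with the best one. *)
Lemma global_min_minimizers (Lt : nat -> seq 'I_N) v :
  (forall v, (1 <= v <= N.-1)%N -> W_minimizer alpha pos AS AD v (Lt v)) ->
  (1 <= v <= N.-1)%N ->
  (forall v', (1 <= v' <= N.-1)%N -> obj (Lt v) <= obj (Lt v')) ->
  global_min (obj (Lt v)).
Proof.
move=> Lt_min v_range v_min; split.
  by exists (Lt v) => //; case: (Lt_min _ v_range).
move=> _ [L pL <-]; have h_range : (1 <= hops L <= N.-1)%N.
  by rewrite hops_gt0// hops_le.
exact: le_trans (v_min _ h_range) (objective_minimizer_le pL (Lt_min _ h_range)).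
Qed.

End Algorithm.

Theorem mainTheorem4 (R : realType) :
  exists C : nat,
  forall (alpha lambdaE : R) (N : nat) (pos : 'I_N -> R * R) (AS AD : 'I_N),
  2 < alpha -> 0 < lambdaE -> (2 <= N)%N -> injective pos -> AS != AD ->
  let obj := objective alpha lambdaE pos in
  let global_min := is_min [set obj L | L in [set L | is_path AS AD L]] in
  let recorded := (result alpha lambdaE (algorithm alpha pos AS AD)).1 in
  let output := (result alpha lambdaE (algorithm alpha pos AS AD)).2 in
  [/\ (forall Lt : nat -> seq 'I_N,
         (forall v, (1 <= v <= N.-1)%N ->
            W_minimizer alpha pos AS AD v (Lt v)) ->
         (exists m, global_min m /\
            is_min [set obj (Lt v) | v in [set v | (1 <= v <= N.-1)%N]] m) /\
         (forall v, (1 <= v <= N.-1)%N ->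
            (forall v', (1 <= v' <= N.-1)%N -> obj (Lt v) <= obj (Lt v')) ->
            global_min (obj (Lt v)))),
      size recorded = N.-1 /\
        (forall v, (1 <= v <= N.-1)%N ->
           W_minimizer alpha pos AS AD v (nth [::] recorded v.-1)),
      output \in recorded /\
        (forall L, L \in recorded -> obj output <= obj L),
      is_path AS AD output /\ global_min (obj output)
    & (cost alpha lambdaE (algorithm alpha pos AS AD) <= C * N ^ 3)%N].
Proof.
exists 20%N => alpha lambdaE N pos AS AD alpha_gt2 lambdaE_gt0 N_ge2 pos_inj ASD
  obj global_min recorded output.
have [rec_size rec_nth out_in out_min] :=
  result_algorithm alpha lambdaE AS AD pos_inj N_ge2.
have rec_min v : (1 <= v <= N.-1)%N ->
    W_minimizer alpha pos AS AD v (nth [::] recorded v.-1).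
  by case: v => // v; exact: rec_nth.
split=> //; last exact: cost_algorithm_le.
- move=> Lt Lt_min; split; last first.
    by move=> v v_range v_min; exact: global_min_minimizers.
  have [|v v_range v_min] := @ex_argmin_range R N.-1 (obj \o Lt).
    by rewrite -ltnS prednK// ltnW.
  exists (obj (Lt v)); split; first exact: global_min_minimizers.
  by split=> [|_ [v' v'_range <-]]; [exists v | exact: v_min].
(* The output sits at some position of the list, counted from 0; the bound [v] is one more. *)
- have [v vN outE] : exists2 v, (1 <= v <= N.-1)%N &
      nth [::] recorded v.-1 = output.
    move: out_in => /(nthP [::])[v]; rewrite rec_size => vN vE.
    by exists v.+1.
  rewrite -outE; split; first by case: (rec_min _ vN).
  (* The recorded paths form an admissible family of minimizers, and the output is best among
     them. *)
  apply: (@global_min_minimizers _ _ _ _ _ _ _ alpha_gt2 lambdaE_gt0 ASD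
    (fun v => nth [::] recorded v.-1)) => // v' /andP[v'_gt0 v'N].
  by rewrite outE; apply: out_min; rewrite mem_nth// rec_size prednK.
Qed.
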